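(* Let $S:[0,1)\to[0,1)$ be an interval translation map and let $\mu$ be a non-atomic $S$-invariant Borel probability measure with support $J$. The following are equivalent: (i) $\mathcal C_{\mathrm{def}}$ is finite; (ii) $\mu$ is branchwise nonsingular on the support and $\mathcal C_{\mathrm{gap}}$ is finite.
   Context: Interval translation map: there are $0=t_0<\dots<t_n=1$ and $c_k\in\mathbb R$ such that, with $I_k=[t_{k-1},t_k)$ (the branches), $S(x)=\tau_k(x):=x+c_k\in[0,1)$ for all $x\in I_k$. $S$-invariance means $\mu(S^{-1}B)=\mu(B)$ for all Borel $B$. The measure $\mu$ is also regarded as a measure on $[0,1]$ with $\mu(\{1\})=0$; $J=\operatorname{supp}\mu$ is closed in $[0,1]$; $h(x)=\mu([0,x])$, $x\in[0,1]$. Branchwise nonsingular on the support: for every branch $I_k$ and every Borel set $N\subset J\cap I_k$ with $\mu(N)=0$ one has $\mu(\tau_k(N))=0$. Canonical defect cut set: for Borel $B\subset I_k$ put $\sigma_k(B)=\mu(\tau_k(B))-\mu(B)$, a finite positive Borel measure on $I_k$; for Borel $E\subset[0,1]$ put $\rho_k(E)=\sigma_k(h^{-1}(E)\cap I_k)$; then $\mathcal C_{\mathrm{def}}=\{h(t_0),\dots,h(t_n)\}\cup\bigcup_{k=1}^n\operatorname{supp}\rho_k$. Active-gap cut set: a branchwise gap in $I_k$ is a connected component $G=(a,b)$ of $(t_{k-1},t_k)\setminus J$; it is active if $\mu(\tau_k(G))>0$; $h(G):=h(a)=h(b)$. $\mathcal C_{\mathrm{gap}}=\{h(G): G\text{ is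 an active branchwise gap in } I_k \text{ for some }k\}$. *)

(* Defs.v *)
From HB Require Import structures.
From mathcomp Require Import all_boot all_order all_algebra.
From mathcomp Require Import all_classical all_reals all_analysis.

Set Implicit Arguments.
Unset Strict Implicit.
Unset Printing Implicit Defensive.

Import Order.TTheory GRing.Theory Num.Theory.
Import numFieldNormedType.Exports.

Local Open Scope classical_set_scope.
Local Open Scope ring_scope.

Section IntervalTranslationMap.
Context {R : realType} {n : nat}.
Variables (t : 'I_n.+1 -> R) (c : 'I_n -> R).

(* Branches are numbered from 0: branch k : 'I_n is [t_k, t_{k+1}). *)
Definition lpt (k : 'I_n) : R := t (widen_ord (leqnSn n) k).
Definition rpt (k : 'I_n) : R := t (lift ord0 k).
Definition branch (k : 'I_n) : set R := `[lpt k, rpt k[.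
Definition tau (k : 'I_n) (x : R) : R := x + c k.

(* S is a total function on R, constrained only on [0, 1). *)
Record is_itm (S : R -> R) : Prop := IsITM {
  itm_t0 : t ord0 = 0;
  itm_t1 : t ord_max = 1;
  itm_lt : forall k, lpt k < rpt k;
  itm_tau : forall k x, branch k x -> S x = tau k x;
  itm_range : forall k x, branch k x -> `[0, 1[%classic (tau k x) }.

End IntervalTranslationMap.

(* The support, in [0, 1], of a set function on the Borel subsets of [0, 1]. *)
Definition supp01 {R : realType} (m : set R -> \bar R) : set R :=
  [set x | `[0, 1]%classic x /\
     forall U : set R, open U -> U x -> (0 < m (U `&` `[0%R, 1%R]))%E].

(* A Borel probability measure on [0, 1) is a Borel probability measure on R
   giving mass 1 to [0, 1); its restriction to [0, 1] does not charge {1}. *)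
Section Measure.
Context {R : realType}.
Variable mu : probability (measurableTypeR R) R.

Definition carried_by_01 : Prop := mu `[0, 1[%classic = 1%E.

Definition nonatomic : Prop := forall x : R, mu [set x] = 0%E.

Definition invariant_measure (S : R -> R) : Prop :=
  forall B : set (measurableTypeR R), measurable B -> B `<=` `[0, 1[%classic ->
    mu (`[0, 1[ `&` S @^-1` B) = mu B.

Definition cdf01 (x : R) : R := fine (mu `[0, x]%classic).

Context {n : nat}.
Variables (t : 'I_n.+1 -> R) (c : 'I_n -> R).
Local Notation J := (supp01 mu).

Definition branchwise_nonsingular : Prop :=
  forall (k : 'I_n) (N : set (measurableTypeR R)),
    measurable N -> N `<=` J `&` branch t k -> mu N = 0%E ->
    mu (tau c k @` N) = 0%E.

Definition sigma (k : 'I_n) (B : set R) : \bar R :=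
  (mu (tau c k @` B) - mu B)%E.

Definition rho (k : 'I_n) (E : set R) : \bar R :=
  sigma k (cdf01 @^-1` E `&` branch t k).

Definition Cdef : set R :=
  range (fun i => cdf01 (t i)) `|` \bigcup_k supp01 (rho k).

Definition off_support (k : 'I_n) : set R := `]lpt t k, rpt t k[ `\` J.

Definition branchwise_gap (k : 'I_n) (a b : R) : Prop :=
  exists2 x, off_support k x &
    connected_component (off_support k) x = `]a, b[%classic.

Definition active (k : 'I_n) (a b : R) : Prop :=
  (0 < mu (tau c k @` `]a, b[%classic))%E.

(* For a gap G = (a, b), h(G) is represented by h(a), which is also h(b). *)
Definition Cgap : set R :=
  [set y | exists k a b,
     [/\ branchwise_gap k a b, active k a b & y = cdf01 a]].

End Measure.

(* Main.v *)
Require Import Defs.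
From HB Require Import structures.
From mathcomp Require Import all_boot all_order all_algebra.
From mathcomp Require Import all_classical all_reals all_analysis.
From mathcomp Require Import measurable_realfun ring lra.

(** By invariance, [sigma k B] is the measure of the points outside [I_k] that
    [S] maps into [tau_k B]; so vanishing of the defect passes to subsets and
    countable unions.

    (i) => (ii): off the fibres of [h] over the finite set [supp rho_k] the
    defect vanishes, and each fibre meets [J] in at most two points, so a null
    subset of [J] has null image. An active gap [G] charges [rho_k] at [h G].

    (ii) => (i): the point is that nonsingularity forces the defect to vanish on
    [J]; then only active gaps contribute, and [supp rho_k] lies in the active
    gap cut set. Otherwise the Hahn decomposition of [mu o tau_k - r mu], for
    some [r > 1], yields a set [A] of positive measure whose subsets in a branch
    are expanded by a factor [r]. A set following a single itinerary for [M]
    steps and visiting [A] at least [v] times then has measure at most [r^-v].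
    But [S] is a piecewise translation on an interval, so it has zero entropy:
    during [N] steps a sufficiently short interval is cut at most once, and its
    translates stay short, so there are only [O(2^(M/N))] itineraries of length
    [M]. Since the mean number of visits to [A] is [M mu(A)], letting [M] go to
    infinity with [N] large and fixed is a contradiction. *)

Set Implicit Arguments.
Unset Strict Implicit.
Unset Printing Implicit Defensive.

Import Order.TTheory GRing.Theory Num.Theory.
Import numFieldNormedType.Exports.

Local Open Scope classical_set_scope.
Local Open Scope ring_scope.

(** * Open sets and order on the real line *)

Section RealLine.
Context {R : realType}.
Implicit Types (A U V : set R) (x y z : R).

(** Since [P] is hereditary, the countably many balls with rational centre and radius that satisfy
    [P] already cover [A]. [P set0] pads the sequence at indices that code no such ball. *)
Lemma lindelof_seq (P : set R -> Prop) A :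
    P set0 -> (forall U V, U `<=` V -> P V -> P U) ->
    (forall x, A x -> exists U, [/\ open U, U x & P U]) ->
  exists F : nat -> set R,
    (forall i, open (F i) /\ P (F i)) /\ A `<=` \bigcup_i F i.
Proof.
move=> P0 PS PA.
pose B (qr : rat * rat) : set R := ball (ratr qr.1 : R) (ratr qr.2).
pose G (o : option (rat * rat)) : set R :=
  if o is Some qr then (if `[< P (B qr) >] then B qr else set0) else set0.
exists (fun i => G (unpickle i)); split.
  move=> i; rewrite /G; case: (unpickle i) => [qr|]; last first.
    by split; [exact: open0|].
  case: asboolP => [PB|_]; last by split; [exact: open0|].
  by split => //; exact: ball_open.
move=> x /PA[U [oU Ux PU]].
have [q [r [xB BU]]] := @open_subball_rat R U x oU (mem_set Ux).
exists (pickle (q, r)); [exact: Logic.I|rewrite pickleK /G].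
case: asboolP => [_|]; first exact: set_mem.
by case; exact: PS PU.
Qed.

(** Every element is [inf A] or [sup A]; any other would lie strictly between two elements. *)
Lemma finite_set_without_middle A :
    (forall x y z, A x -> A y -> A z -> x < y -> ~ y < z) -> finite_set A.
Proof.
move=> Amid; apply: (@sub_finite_set _ _ [set inf A; sup A]); last first.
  exact: finite_set2.
move=> y Ay.
have [/eqP yi|yi] := eqVneq y (inf A); first by left; exact/eqP.
have [/eqP ys|ys] := eqVneq y (sup A); first by right; exact/eqP.
exfalso.
have [[x Ax xy]|nlt] := pselect (exists2 x, A x & x < y); last first.
  case/negP: yi; rewrite eq_le; apply/andP; split.
    apply: lb_le_inf; first by exists y.
    by move=> x Ax; rewrite leNgt; apply/negP => xy; apply: nlt; exists x.
  apply: ge_inf => //; exists y => x Ax.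
  by rewrite leNgt; apply/negP => xy; apply: nlt; exists x.
have [[z Az yz]|ngt] := pselect (exists2 z, A z & y < z).
  exact: Amid Ax Ay Az xy yz.
case/negP: ys; rewrite eq_le; apply/andP; split; last first.
  apply: ge_sup; first by exists y.
  by move=> z Az; rewrite leNgt; apply/negP => yz; apply: ngt; exists z.
apply: ub_le_sup => //; exists y => z Az.
by rewrite leNgt; apply/negP => yz; apply: ngt; exists z.
Qed.

(** A component is an interval, and it is open: a small ball in [A] around one of its points is
    connected, hence stays inside it. *)
Lemma bounded_open_component A x : open A -> has_lbound A -> has_ubound A ->
  A x -> exists a b, connected_component A x = `]a, b[%classic.
Proof.
move=> oA lA uA Ax; set C := connected_component A x.
have CA : C `<=` A by exact: connected_component_sub.
have iC : is_interval C.
  by apply/connected_intervalP; exact: component_connected.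
exists (inf C), (sup C).
have -> : `]inf C, sup C[%classic = [set r | inf C < r < sup C].
  by apply/seteqP; split => r /=; rewrite in_itv.
rewrite -interval_bounded_interior//; first last.
- by apply: subset_has_ubound uA.
- by apply: subset_has_lbound lA.
apply/seteqP; split; last exact: interior_subset.
move=> y Cy; have /(open_subball oA)[e/= e0 eA] := CA _ Cy.
(* [open_subball] speaks of radii strictly below [e], hence the half. *)
pose d := e / 2.
have d0 : 0 < d by rewrite divr_gt0.
have dy : ball y d y by exact: ballxx.
have /= := eA d; rewrite sub0r normrN gtr0_norm// ltr_pdivrMr// ltr_pMr// ltr1n.
move=> /(_ isT d0) dA; rewrite /interior -nbhs_ballE; exists d => // z yz.
have : connected_component A y z.
  apply: (connected_component_max dy dA) yz.
  by apply/connected_intervalP; rewrite ball_itv; exact: interval_is_interval.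
by apply: connected_component_trans.
Qed.

End RealLine.

(** * Branches *)

Section Itm.
Context {R : realType} {n : nat}.
Variables (t : 'I_n.+1 -> R) (c : 'I_n -> R) (S : R -> R).
Hypothesis hS : is_itm t c S.
Implicit Types (A B : set (measurableTypeR R)) (k : 'I_n) (x y : R).

Let lptE k : lpt t k = t (inord k).
Proof.
by congr t; apply: val_inj; rewrite /= inordK// ltnS ltnW.
Qed.

Let rptE k : rpt t k = t (inord k.+1).
Proof. by congr t; apply: val_inj; rewrite /= inordK// ltnS. Qed.

Let t_nd (i j : nat) : (i <= j)%N -> (j <= n)%N ->
  t (inord i) <= t (inord j).
Proof.
elim: j => [|j IH]; first by rewrite leqn0 => /eqP->.
rewrite leq_eqVlt => /predU1P[->//|ij] jn.
apply: le_trans (IH ij (ltnW jn)) _.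
by have := itm_lt hS (Ordinal jn); rewrite lptE rptE => /ltW.
Qed.

Let t0 : t (inord 0) = 0.
Proof.
by rewrite -(itm_t0 hS); congr t; apply: val_inj; rewrite /= inordK.
Qed.

Let t1 : t (inord n) = 1.
Proof.
by rewrite -(itm_t1 hS); congr t; apply: val_inj; rewrite /= inordK.
Qed.

Lemma lpt_ge0 k : 0 <= lpt t k.
Proof. by rewrite lptE -t0 t_nd// ltnW. Qed.

Lemma rpt_le1 k : rpt t k <= 1.
Proof. by rewrite rptE -t1 t_nd. Qed.

Lemma branch_sub01 k : branch t k `<=` `[0, 1[.
Proof.
move=> x; rewrite /branch /= !in_itv/= => /andP[lx xr].
by rewrite (le_trans (lpt_ge0 k) lx) (lt_le_trans xr (rpt_le1 k)).
Qed.

Lemma branch_cover x : `[0, 1[%classic x -> exists k, branch t k x.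
Proof.
rewrite /= in_itv/= => /andP[x0 x1].
suff H m : (m <= n)%N -> x < t (inord m) -> exists k, branch t k x.
  by apply: (H n) => //; rewrite t1.
elim: m => [_|m IH mn xm].
  by rewrite t0 ltNge x0.
have [/(IH (ltnW mn))//|mx] := ltP x (t (inord m)).
exists (Ordinal mn); rewrite /branch /= in_itv/= lptE rptE /=.
by rewrite mx xm.
Qed.

Lemma itm_S01 x : `[0, 1[%classic x -> `[0, 1[%classic (S x).
Proof.
by move=> /branch_cover[k xk]; rewrite (itm_tau hS xk); exact: itm_range hS _ _ xk.
Qed.

Lemma iter_itm01 i x : `[0, 1[%classic x -> `[0, 1[%classic (iter i S x).
Proof. by move=> x01; elim: i => //= i IH; exact: itm_S01. Qed.

Lemma tau_imageE k (B : set R) : tau c k @` B = (fun y => y - c k) @^-1` B.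
Proof.
apply/seteqP; split => [_ [x Bx <-]|y By] /=; first by rewrite /tau addrK.
by exists (y - c k) => //; rewrite /tau subrK.
Qed.

Lemma measurable_translate (a : R) B :
  measurable B -> measurable ((fun y : R => y + a) @^-1` B : set (measurableTypeR R)).
Proof.
move=> mB; rewrite -[X in measurable X]setTI.
have : measurable_fun setT (fun y : measurableTypeR R => y + a : measurableTypeR R).
  exact: measurable_funD.
by apply.
Qed.

Lemma measurable_tau k B :
  measurable B -> measurable (tau c k @` B : set (measurableTypeR R)).
Proof. by move=> mB; rewrite tau_imageE; exact: measurable_translate. Qed.

Lemma measurable_branch k : measurable (branch t k : set (measurableTypeR R)).
Proof. exact: measurable_itv. Qed.

(** [S] is arbitrary off the unit interval, so the preimage is restricted to it and cut into
    branches, on each of which [S] is a translation. *)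
Lemma measurable_itm_preimage B : measurable B ->
  measurable (`[0, 1[ `&` S @^-1` B : set (measurableTypeR R)).
Proof.
move=> mB.
have -> : `[0, 1[ `&` S @^-1` B =
    \bigcup_(k in [set: 'I_n]) (branch t k `&` (fun y => y + c k) @^-1` B).
  apply/seteqP; split => [x [/branch_cover[k xk] SB]|x [k _ [xk SB]]].
    by exists k => //; split => //=; move: SB; rewrite /= (itm_tau hS xk).
  by split; [exact: branch_sub01 xk|rewrite /= (itm_tau hS xk)].
apply: fin_bigcup_measurable; first exact: finite_finset.
move=> k _; apply: measurableI; first exact: measurable_branch.
exact: measurable_translate.
Qed.

End Itm.

(** * Distribution function and support *)

Section NonatomicMeasure.
Context {R : realType}.
Variable mu : probability (measurableTypeR R) R.
Hypotheses (hmu01 : carried_by_01 mu) (hna : nonatomic mu).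
Implicit Types (A B N : set (measurableTypeR R)) (x y : R).

Local Notation J := (supp01 mu).
Local Notation h := (cdf01 mu).

Lemma mu_fin A : measurable A -> mu A \is a fin_num.
Proof. exact: fin_num_measure. Qed.

Lemma mu_null_sub A B : measurable A -> A `<=` B -> mu.-negligible B -> mu A = 0%E.
Proof.
by move=> mA AB nB; apply/(measure_negligible mA); exact: negligibleS nB.
Qed.

Lemma null_negligible A : measurable A -> mu A = 0%E -> mu.-negligible A.
Proof. by move=> mA A0; apply/negligibleP. Qed.

Lemma carried01_setC : mu (~` `[0, 1[%classic) = 0%E.
Proof.
rewrite probability_setC; last exact: measurable_itv.
by rewrite hmu01 subee.
Qed.

Lemma carried01_setI A : measurable A -> mu (A `&` `[0, 1[) = mu A.
Proof.
move=> mA; apply/esym.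
rewrite (measureDI mu mA (measurable_itv `[0, 1[)).
rewrite [X in (X + _)%E](_ : _ = 0%E) ?add0e//.
apply: (@mu_null_sub _ (~` `[0, 1[%classic)).
- by apply: measurableD => //; exact: measurable_itv.
- by move=> z [].
- apply: null_negligible; last exact: carried01_setC.
  by apply: measurableC; exact: measurable_itv.
Qed.

Lemma nonatomic_finite A : finite_set A -> mu.-negligible A.
Proof.
move=> /finite_seqP[s ->]; elim: s => [|x s IH].
  rewrite (_ : [set` _] = set0); first exact: negligible_set0.
  by apply/seteqP; split.
rewrite (_ : [set` x :: s] = [set x] `|` [set` s]).
  apply: negligibleU => //; apply: null_negligible; last exact: hna.
  exact: measurable_set1.
apply/seteqP; split => y /=.
  by rewrite inE => /predU1P[->|ys]; [left|right].
by move=> [->|ys]; rewrite inE ?eqxx// ys orbT.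
Qed.

Lemma cdf01_nd : nondecreasing_fun h.
Proof.
move=> x y xy; rewrite /cdf01 fine_le ?mu_fin//; try exact: measurable_itv.
apply: le_measure; rewrite ?inE; try exact: measurable_itv.
by apply: subset_itvl; rewrite bnd_simp.
Qed.

Lemma cdf01_01 x : `[0, 1]%classic (h x).
Proof.
rewrite /= in_itv/= /cdf01; apply/andP; split; first exact/fine_ge0.
rewrite -[1]/(fine (1%E : \bar R)) fine_le ?mu_fin//; try exact: measurable_itv.
by apply: probability_le1; exact: measurable_itv.
Qed.

Lemma measurable_cdf01 (E : set R) : measurable (E : set (measurableTypeR R)) ->
  measurable (h @^-1` E : set (measurableTypeR R)).
Proof.
move=> mE; rewrite -[X in measurable X]setTI.
exact: (nondecreasing_measurable measurableT cdf01_nd).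
Qed.

Lemma cdf01_const a b x : mu `]a, b[%classic = 0%E -> a < x < b -> h x = h a.
Proof.
move=> ab0 /andP[ax xb]; apply/eqP; rewrite eq_le; apply/andP; split; last first.
  exact/cdf01_nd/ltW.
rewrite /cdf01 fine_le ?mu_fin//; try exact: measurable_itv.
rewrite -[leRHS]adde0 -ab0; apply: le_trans; last first.
  by apply: measureU2; exact: measurable_itv.
apply: le_measure; rewrite ?inE; try exact: measurable_itv.
  by apply: measurableU; exact: measurable_itv.
move=> y; rewrite /= !in_itv/= => /andP[y0 yx].
have [ya|ay] := leP y a; first by left; rewrite y0.
by right; rewrite (le_lt_trans yx).
Qed.

(** The complement of the support as a union of open null sets; being open, it yields the
    measurability of [J]. *)
Definition null_pts : set R :=
  \bigcup_(U in [set U : set R | open U /\ mu (U `&` `[0, 1]%classic) = 0%E]) U.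

Let open_null_pts : open null_pts.
Proof. by apply: bigcup_open => U []. Qed.

Lemma supp01E : J = `[0, 1]%classic `\` null_pts.
Proof.
apply/seteqP; split => x.
  move=> [x01 xU]; split => // -[U [oU U0] Ux].
  by have := xU U oU Ux; rewrite U0 ltxx.
move=> [x01 xU]; split => // U oU Ux; rewrite lt0e measure_ge0 andbT.
by apply/eqP => U0; apply: xU; exists U.
Qed.

Lemma measurable_supp01 : measurable (J : set (measurableTypeR R)).
Proof.
rewrite supp01E; apply: measurableD; first exact: measurable_itv.
exact: open_measurable.
Qed.

Lemma open_setD_supp01 a b : 0 <= a -> b <= 1 -> open (`]a, b[%classic `\` J).
Proof.
move=> a0 b1.
have -> : `]a, b[%classic `\` J = `]a, b[%classic `&` null_pts.
  rewrite supp01E; apply/seteqP; split => [x [xab xJ]|x [xab xn]].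
    split => //; apply: contrapT => xn; apply: xJ; split => //.
    move: xab; rewrite /= !in_itv/= => /andP[ax xb].
    by rewrite (le_trans a0 (ltW ax)) (le_trans (ltW xb) b1).
  by split => // -[].
apply: openI => //; exact: interval_open.
Qed.

(** [null_pts] is a possibly uncountable union of null sets; the Lindelof property reduces it to a
    countable one. *)
Lemma supp01_setC_negligible : mu.-negligible (~` J).
Proof.
have [|||F [FP Fcov]] := @lindelof_seq R (fun U => mu.-negligible (U `&` `[0, 1]%classic)) null_pts.
- by rewrite set0I; exact: negligible_set0.
- by move=> U V UV; apply: negligibleS; exact: setSI.
- move=> x [U [oU U0] Ux]; exists U; split => //; apply: null_negligible => //.
  by apply: measurableI; [exact: open_measurable|exact: measurable_itv].
apply: (@negligibleS _ _ _ mu ((~` `[0, 1[%classic) `|` \bigcup_i (F i `&` `[0, 1]%classic))).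
  move=> x xJ; have [x01|x01] := pselect (`[0, 1[%classic x); last by left.
  have x01' : `[0, 1]%classic x.
    by move: x01; rewrite /= !in_itv/= => /andP[-> /ltW].
  right; have [//|i _ Fx] := Fcov x.
    by apply: contrapT => xn; apply: xJ; rewrite supp01E.
  by exists i.
apply: negligibleU; last by apply: negligible_bigcup => i; have [] := FP i.
apply: null_negligible; last exact: carried01_setC.
by apply: measurableC; exact: measurable_itv.
Qed.

(** If [x1 < x2 < x3] in [J] had the same value of [h], then []x1, x3[] would be a null
    neighbourhood of [x2]. *)
Lemma supp01_cdf01_fiber_finite y : finite_set (J `&` h @^-1` [set y]).
Proof.
apply: finite_set_without_middle => x1 x2 x3 [J1 h1] [J2 h2] [J3 h3] x12 x23.
have [_ /(_ `]x1, x3[%classic)] := J2.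
have oI : open `]x1, x3[%classic by exact: interval_open.
move=> /(_ oI); rewrite /= in_itv/= x12 x23 => /(_ isT).
apply/negP; rewrite -leNgt.
have x10 : 0 <= x1.
  by case: J1; rewrite /= in_itv/= => /andP[].
have E : mu `[0, x3]%classic = (mu `[0%R, x1]%classic + mu `]x1, x3]%classic)%E.
  rewrite -measureU; [|exact: measurable_itv|exact: measurable_itv|].
    by rewrite -itv_bndbnd_setU// bnd_simp ?ltW// (lt_trans x12).
  apply/seteqP; split => // z []; rewrite /= !in_itv/= => /andP[_ zx] /andP[xz _].
  by move: (lt_le_trans xz zx); rewrite ltxx.
have F : mu `]x1, x3]%classic = 0%E.
  have f1 : mu `[0, x1]%classic \is a fin_num by apply: mu_fin; exact: measurable_itv.
  have f2 : mu `[0, x3]%classic \is a fin_num by apply: mu_fin; exact: measurable_itv.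
  have f3 : mu `]x1, x3]%classic \is a fin_num by apply: mu_fin; exact: measurable_itv.
  move: h1 h3; rewrite /= /cdf01 E fineD// => <- /eqP.
  rewrite -subr_eq0 addrC addKr => /eqP f0.
  by rewrite -(fineK f3) f0.
rewrite -F; apply: le_measure; rewrite ?inE; last first.
- by move=> z []; rewrite /= !in_itv/= => /andP[-> /ltW].
- exact: measurable_itv.
- by apply: measurableI; exact: measurable_itv.
Qed.

End NonatomicMeasure.

(** * The defect *)

Section Defect.
Context {R : realType} {n : nat}.
Variables (t : 'I_n.+1 -> R) (c : 'I_n -> R) (S : R -> R).
Variable mu : probability (measurableTypeR R) R.
Hypotheses (hS : is_itm t c S) (hmu01 : carried_by_01 mu).
Hypothesis hinv : invariant_measure mu S.
Implicit Types (A B : set (measurableTypeR R)) (k : 'I_n) (x y : R).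

(** Invariance extends to all Borel [B] because [mu] ignores the part of [B] off the unit interval
    and [S] never enters it. *)
Lemma invariant_preimage B : measurable B ->
  mu (`[0, 1[ `&` S @^-1` B) = mu B.
Proof.
move=> mB; rewrite -[RHS](carried01_setI hmu01 mB) -[RHS]hinv.
- congr (mu _); apply/seteqP; split => [x [x01 SB]|x [x01 [SB _]]]; split => //.
  by split => //; exact: (itm_S01 hS).
- by apply: measurableI => //; exact: measurable_itv.
- by move=> x [].
Qed.

(* Invariance splits [mu (tau_k B)] into the part of the preimage in [I_k],
   which is [B], and this one, whose measure is [sigma k B]. *)
Definition other_preimages k B : set (measurableTypeR R) :=
  (`[0, 1[%classic `\` branch t k) `&` S @^-1` (tau c k @` B).

Lemma measurable_other_preimages k B : measurable B -> measurable (other_preimages k B).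
Proof.
move=> mB; rewrite /other_preimages setIDAC setIDA; apply: measurableD.
  by apply: (measurable_itm_preimage hS); exact: measurable_tau.
exact: measurable_branch.
Qed.

Lemma mu_tauE k B : measurable B -> B `<=` branch t k ->
  mu (tau c k @` B) = (mu B + mu (other_preimages k B))%E.
Proof.
move=> mB Bk; rewrite -invariant_preimage; last exact: measurable_tau.
rewrite (measureDI mu (measurable_itm_preimage hS (measurable_tau c k mB)) (measurable_branch t k)).
rewrite addeC; congr (mu _ + mu _)%E; last by rewrite /other_preimages setIDAC setIDA.
apply/seteqP; split => [x [[_ [z Bz zx]] xk]|x Bx].
  by move: zx; rewrite (itm_tau hS xk) => /addIr <-.
split; last exact: Bk.
split; first exact: (branch_sub01 hS (Bk _ Bx)).
by exists x => //; rewrite (itm_tau hS (Bk _ Bx)).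
Qed.

Lemma sigmaE k B : measurable B -> B `<=` branch t k ->
  sigma mu c k B = mu (other_preimages k B).
Proof.
by move=> mB Bk; rewrite /sigma mu_tauE// [X in (X - _)%E]addeC addeK// mu_fin.
Qed.

Lemma le_mu_tau k B : measurable B -> B `<=` branch t k ->
  (mu B <= mu (tau c k @` B))%E.
Proof. by move=> mB Bk; rewrite mu_tauE// leeDl. Qed.

Lemma other_preimagesS k A B : A `<=` B -> other_preimages k A `<=` other_preimages k B.
Proof.
by move=> AB; apply: setIS; apply: preimage_subset; exact: image_subset.
Qed.

Lemma other_preimages_bigcup k (F : nat -> set R) :
  other_preimages k (\bigcup_i F i) = \bigcup_i other_preimages k (F i).
Proof. by rewrite /other_preimages image_bigcup preimage_bigcup setI_bigcupr. Qed.

End Defect.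

(** * Counting itineraries *)

Section Counting.
Context {R : realType} {n : nat}.
Variables (t : 'I_n.+1 -> R) (c : 'I_n -> R) (S : R -> R).
Hypothesis hS : is_itm t c S.
Implicit Types (B : set R) (k : 'I_n) (x y : R).

Definition const_itinerary (M : nat) B : Prop :=
  forall i, (i < M)%N -> exists k, forall x, B x -> branch t k (iter i S x).

Lemma const_itinerary_translation M B :
  const_itinerary M B -> exists e, forall x, B x -> iter M S x = x + e.
Proof.
elim: M => [_|M IH cB]; first by exists 0 => x _; rewrite addr0.
have [|e eB] := IH; first by move=> i iM; apply: cB; rewrite ltnS ltnW.
have [k Bk] := cB _ (ltnSn M).
exists (e + c k) => x Bx; rewrite iterS (itm_tau hS (Bk _ Bx)) eB//.
by rewrite /tau addrA.
Qed.

Lemma const_itineraryS M B B' :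
  B' `<=` B -> const_itinerary M B -> const_itinerary M B'.
Proof. by move=> BB cB i /cB[k Bk]; exists k => x /BB/Bk. Qed.

(** Branches are closed on the left, so the cut at [t i] separates [x < y] exactly when
    [x < t i <= y]. *)
Lemma same_branch x y : x < y ->
    (forall i, ~~ ((x < t i) && (t i <= y))) ->
  forall k, branch t k x <-> branch t k y.
Proof.
move=> xy H k.
have := H (widen_ord (leqnSn n) k); have := H (lift ord0 k).
rewrite -/(rpt t k) -/(lpt t k) /branch /= !in_itv/= !negb_and -!leNgt -!ltNge.
move=> /orP Hr /orP Hl; split => /andP[h1 h2]; apply/andP; split.
- exact: le_trans h1 (ltW xy).
- by case: Hr => // h3; have := lt_le_trans h2 h3; rewrite ltxx.
- by case: Hl => // h3; have := le_lt_trans h1 h3; rewrite ltxx.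
- exact: lt_trans xy h2.
Qed.

(* Inductively the break points are the [t_i] and the [d - c_k], [d] a break
   point for [N] steps. *)
Lemma itinerary_breaks N : exists D : seq R, forall x y,
  `[0, 1[%classic x -> `[0, 1[%classic y -> x < y ->
  (forall d, d \in D -> ~~ ((x < d) && (d <= y))) ->
  forall i, (i < N)%N -> forall k,
    branch t k (iter i S x) <-> branch t k (iter i S y).
Proof.
elim: N => [|N [D HD]]; first by exists [::].
exists (codom t ++ [seq d - c k | d <- D, k <- enum 'I_n]).
move=> x y x01 y01 xy H.
have xyk : forall k, branch t k x <-> branch t k y.
  by apply: same_branch => // i; apply: H; rewrite mem_cat codom_f.
case=> [//|i]; rewrite ltnS => iN k; rewrite !iterSr.
have [k0 xk0] := branch_cover hS x01.
have yk0 := (xyk k0).1 xk0.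
have Sx := itm_tau hS xk0; have Sy := itm_tau hS yk0.
apply: HD => //; try exact: (itm_S01 hS).
  by rewrite Sx Sy ltrD2r.
move=> d dD; rewrite Sx Sy /tau -ltrBrDr -lerBlDr.
apply: H; rewrite mem_cat; apply/orP; right.
by apply/allpairsP; exists (d, k0); rewrite mem_enum.
Qed.

(** The least positive difference serves as [delta]. A set of smaller diameter is then cut by at
    most one point of [D]. *)
Lemma seq_gap (D : seq R) : exists2 delta, 0 < delta &
  forall d d', d \in D -> d' \in D -> d < d' -> delta <= d' - d.
Proof.
pose L := [seq d' - d | d <- D, d' <- D].
suff [e e0 He] : exists2 e, 0 < e & forall l, l \in L -> 0 < l -> e <= l.
  exists e => // d d' dD dD' dd; apply: He; last by rewrite subr_gt0.
  by apply/allpairsP; exists (d, d').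
elim: L => [|l L [e e0 He]]; first by exists 1.
have [l0|l0] := ltP 0 l.
  exists (Num.min e l); first by rewrite lt_min e0.
  move=> a; rewrite inE => /predU1P[->|aL] a0; first by rewrite ge_min lexx orbT.
  by rewrite ge_min He.
exists e => // a; rewrite inE => /predU1P[->|aL] a0; last exact: He.
by have := lt_le_trans a0 l0; rewrite ltxx.
Qed.

End Counting.

(** * No set of positive measure is expanded *)

Section Expansion.
Context {R : realType} {n : nat}.
Variables (t : 'I_n.+1 -> R) (c : 'I_n -> R) (S : R -> R).
Variable mu : probability (measurableTypeR R) R.
Hypotheses (hS : is_itm t c S) (hmu01 : carried_by_01 mu).
Hypothesis hinv : invariant_measure mu S.
Variables (A : set (measurableTypeR R)) (r : R).
Hypotheses (mA : measurable A) (r1 : 1 < r).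
Hypothesis expA : forall (k : 'I_n) (B : set (measurableTypeR R)),
  measurable B -> B `<=` A `&` branch t k ->
  r * fine (mu B) <= fine (mu (tau c k @` B)).
Implicit Types (B : set (measurableTypeR R)) (k : 'I_n) (x y : R).

Local Notation m B := (fine (mu B)).

Definition visits (M : nat) x : nat := \sum_(i < M) `[< A (iter i S x) >].

Lemma visitsS M x : visits M.+1 x = (`[< A x >] + visits M (S x))%N.
Proof.
rewrite /visits big_ord_recl; congr (_ + _)%N.
by apply: eq_bigr => i _; rewrite /= /bump /= -iterS iterSr.
Qed.

Let m_split B C : measurable B -> measurable C ->
  m B = m (B `&` C) + m (B `\` C).
Proof.
move=> mB mC; rewrite (measureDI mu mB mC) addeC fineD//.
- by apply: mu_fin; exact: measurableI.
- by apply: mu_fin; exact: measurableD.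
Qed.

Let m_le1 B : measurable B -> m B <= 1.
Proof.
move=> mB; rewrite -[1]/(fine (1%E : \bar R)) fine_le ?mu_fin//.
exact: probability_le1.
Qed.

Let m_ge0 B : 0 <= m B. Proof. exact: fine_ge0. Qed.

(** The right-hand side measures the image of [B] under [S^M]. In the first step the part of [B] in
    [A] gains a factor [r] and owes one visit less; the rest does not lose measure, by
    invariance. *)
Let mu_translate_ge M B v e : measurable B -> const_itinerary t S M B ->
  (forall x, B x -> iter M S x = x + e) ->
  (forall x, B x -> (v <= visits M x)%N) ->
  r ^+ v * m B <= m ((fun y => y - e) @^-1` B).
Proof.
elim: M B v e => [|M IH] B v e mB cB eB vB.
  have [B0|/set0P[x Bx]] := eqVneq B set0.
    by rewrite B0 measure0 mulr0.
  have e0 : e = 0 by have /= := eB _ Bx; lra.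
  have := vB _ Bx; rewrite /visits big_ord0 leqn0 => /eqP ->.
  rewrite expr0 mul1r e0 (_ : _ @^-1` _ = B)//.
  by apply/seteqP; split => y /=; rewrite subr0.
have [k Bk] := cB 0%N isT.
have SB x : B x -> S x = x + c k by move=> Bx; rewrite (itm_tau hS (Bk _ Bx)).
(* Induction hypothesis for the image of [C] after one step, whose remaining translation is
   [e - c k]. *)
have H C w : measurable C -> C `<=` B ->
    (forall x, C x -> (w <= visits M (S x))%N) ->
    r ^+ w * m (tau c k @` C) <= m ((fun y => y - e) @^-1` C).
  move=> mC CB wC.
  rewrite (_ : _ @^-1` C = (fun y => y - (e - c k)) @^-1` (tau c k @` C)); last first.
    rewrite tau_imageE; apply/seteqP; split => y /=;
      by rewrite (_ : y - (e - c k) - c k = y - e)//; lra.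
  apply: IH.
  - exact: measurable_tau.
  - move=> i iM; have [k' Bk'] := cB i.+1 iM; exists k' => _ [x Cx <-].
    by rewrite /tau -SB -?iterSr; [exact/Bk'/CB|exact: CB].
  - move=> _ [x Cx <-]; rewrite {1}/tau -SB -?iterSr; last exact: CB.
    by rewrite eB /tau; [lra|exact: CB].
  - by move=> _ [x Cx <-]; rewrite /tau -SB; [exact: wC|exact: CB].
rewrite (m_split mB mA) mulrDr.
have msh : measurable ((fun y : R => y - e) @^-1` B : set (measurableTypeR R)).
  exact: measurable_translate.
rewrite (m_split msh (measurable_translate (- e) mA)).
have mBA : measurable (B `&` A) by exact: measurableI.
have mBD : measurable (B `\` A) by exact: measurableD.
have r0 : 0 <= r by rewrite ltW// (lt_trans _ r1).
apply: lerD.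
- apply: le_trans (H _ v.-1 mBA _ _); first last.
  + move=> x [Bx Ax]; have := vB _ Bx; rewrite visitsS.
    by rewrite (asboolT Ax) add1n; case: v {vB H}.
  + by move=> x [].
  apply: (@le_trans _ _ (r ^+ v.-1 * (r * m (B `&` A)))); last first.
    apply: ler_wpM2l; first exact: exprn_ge0.
    by apply: expA => // x [Bx Ax]; split => //; exact: Bk.
  (* For [v = 0] the predecessor is 0 as well, and [r ^+ 0 <= r ^+ 1] suffices. *)
  rewrite mulrA -exprSr; apply: ler_wpM2r => //.
  by apply: ler_weXn2l; [exact: ltW|case: (v)].
- apply: le_trans (H _ v mBD _ _); first last.
  + move=> x [Bx Ax]; have := vB _ Bx; rewrite visitsS.
    by rewrite (asboolF Ax).
  + by move=> x [].
  apply: ler_wpM2l; first exact: exprn_ge0.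
  rewrite fine_le ?mu_fin//; first exact: measurable_tau.
  by apply: (le_mu_tau hS hmu01 hinv) => // x [Bx _]; exact: Bk.
Qed.

Lemma growth_bound M B v : measurable B -> const_itinerary t S M B ->
  (forall x, B x -> (v <= visits M x)%N) -> r ^+ v * m B <= 1.
Proof.
move=> mB cB vB; have [e eB] := const_itinerary_translation hS cB.
apply: le_trans (mu_translate_ge mB cB eB vB) _.
by apply: m_le1; exact: measurable_translate.
Qed.

(** * Cutting along blocks of [N] steps *)

Section Blocks.
Variables (N : nat) (D : seq R) (delta : R).
Hypothesis breaks : forall x y,
  `[0, 1[%classic x -> `[0, 1[%classic y -> x < y ->
  (forall d, d \in D -> ~~ ((x < d) && (d <= y))) ->
  forall i, (i < N)%N -> forall k,
    branch t k (iter i S x) <-> branch t k (iter i S y).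
Hypothesis gapD : forall d d', d \in D -> d' \in D -> d < d' -> delta <= d' - d.

(** At time [j] the set is [B + e]; if no break point separates two of its points, they share the
    next [N] branches. *)
Let extend_itinerary j B e : B `<=` `[0, 1[ -> B !=set0 ->
  const_itinerary t S j B -> (forall x, B x -> iter j S x = x + e) ->
  (forall x y d, B x -> B y -> d \in D -> ~~ ((x + e < d) && (d <= y + e))) ->
  const_itinerary t S (j + N) B.
Proof.
move=> B01 [x0 Bx0] cB eB nD i; have [ij _|ji iN] := ltnP i j; first exact: cB.
have same x y : B x -> B y -> forall k,
    branch t k (iter i S x) -> branch t k (iter i S y).
  move=> Bx By k; rewrite -(subnK ji) !iterD.
  have ijN : (i - j < N)%N by rewrite ltn_subLR.
  have [xy|yx|->//] := ltgtP x y.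
    apply: (breaks _ _ _ _ ijN k).1; try exact/(iter_itm01 hS)/B01.
      by rewrite !eB// ltrD2r.
    by move=> d dD; rewrite !eB//; exact: nD.
  apply: (breaks _ _ _ _ ijN k).2; try exact/(iter_itm01 hS)/B01.
    by rewrite !eB// ltrD2r.
  by move=> d dD; rewrite !eB//; exact: nD.
have [k0 Hk0] := branch_cover hS (iter_itm01 hS i (B01 _ Bx0)).
by exists k0 => x Bx; exact: same Hk0.
Qed.

(* After [j] steps the set is translated as a whole; being shorter than the
   gaps of [D] it contains at most one break point, so [N] more steps need only
   one cut. *)
Lemma block_bound q j B v : measurable B -> B `<=` `[0, 1[ ->
  const_itinerary t S j B -> (forall x y, B x -> B y -> y - x < delta) ->
  (forall x, B x -> (v <= visits (j + q * N) x)%N) ->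
  r ^+ v * m B <= 2 ^+ q.
Proof.
elim: q j B => [|q IH] j B mB B01 cB dB vB.
  by rewrite expr0; apply: (growth_bound mB cB) => x /vB; rewrite mul0n addn0.
have [e eB] := const_itinerary_translation hS cB.
have H C : measurable C -> C `<=` B ->
    (forall x y d, C x -> C y -> d \in D -> ~~ ((x + e < d) && (d <= y + e))) ->
    r ^+ v * m C <= 2 ^+ q.
  move=> mC CB CD; have [C0|/set0P C0] := eqVneq C set0.
    by rewrite C0 measure0 mulr0 exprn_ge0.
  apply: (IH (j + N)%N) => //.
  - exact: subset_trans CB B01.
  - apply: (extend_itinerary _ C0 _ _ CD) => //.
    + exact: subset_trans CB B01.
    + exact: const_itineraryS cB.
    + by move=> x /CB/eB.
  - by move=> x y /CB Bx /CB By; exact: dB.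
  - by move=> x /CB/vB; rewrite -addnA -mulSn.
have [[d [x [y [dD Bx By /andP[xd dy]]]]]|nd] := pselect (exists d x y,
    [/\ d \in D, B x, B y & (x + e < d) && (d <= y + e)]); last first.
  apply: (@le_trans _ _ (2 ^+ q)).
    apply: H => // x y d Bx By dD; apply/negP => xdy; apply: nd.
    by exists d, x, y.
  by apply: ler_weXn2l; rewrite ?ler1n.
have md : measurable (`]-oo, d - e[%classic : set (measurableTypeR R)) by exact: measurable_itv.
rewrite (m_split mB md) mulrDr exprS mulr_natl mulr2n; apply: lerD; apply: H.
- exact: measurableI.
- by move=> z [].
- move=> x' y' d' [Bx' _] [By' /=]; rewrite in_itv/= => y'd d'D.
  apply/negP => /andP[xd' d'y].
  have d'd : d' < d by lra.
  have := gapD d'D dD d'd; have := dB _ _ Bx' By; lra.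
- exact: measurableD.
- by move=> z [].
- move=> x' y' d' [Bx' /=]; rewrite in_itv/= => /negP; rewrite -leNgt => dx' [By' _] d'D.
  apply/negP => /andP[xd' d'y].
  have d'd : d < d' by lra.
  have := gapD dD d'D d'd; have := dB _ _ Bx By'; lra.
Qed.

End Blocks.

(** * Mean number of visits *)

Definition often (M v : nat) : set (measurableTypeR R) :=
  `[0, 1[%classic `&` [set x | (v <= visits M x)%N].

Let A_ i : set (measurableTypeR R) := `[0, 1[%classic `&` iter i S @^-1` A.

Let mA_ i : measurable (A_ i) /\ mu (A_ i) = mu A.
Proof.
elim: i => [|i [mAi eAi]].
  split; first by apply: measurableI => //; exact: measurable_itv.
  by rewrite /A_ setIC; exact: carried01_setI.
have -> : A_ i.+1 = `[0, 1[ `&` S @^-1` (A_ i).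
  apply/seteqP; split => x [x01]; rewrite /A_ /= -iterS iterSr.
    by move=> Ax; split => //; split => //; exact: (itm_S01 hS).
  by move=> [_ Ax]; split.
split; first exact: (measurable_itm_preimage hS).
by rewrite (invariant_preimage hS hmu01 hinv).
Qed.

Let visits_indic M x : `[0, 1[%classic x ->
  (visits M x)%:R = \sum_(i < M) \1_(A_ i) x :> R.
Proof.
move=> x01; rewrite /visits natr_sum; apply: eq_bigr => i _.
rewrite indicE; congr (_%:R); congr nat_of_bool.
apply/asboolP/idP => [Ax|]; first by apply/mem_set.
by move/set_mem => [].
Qed.

Lemma measurable_often M v : measurable (often M v).
Proof.
pose f := fun x : measurableTypeR R => \sum_(i < M) \1_(A_ i) x : R.
have mf : measurable_fun setT f.
  apply: measurable_sum => i; apply: measurable_indic; exact: (mA_ i).1.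
have -> : often M v = `[0, 1[%classic `&` f @^-1` `[v%:R, +oo[%classic.
  have fE x : `[0, 1[%classic x -> (f @^-1` `[v%:R, +oo[%classic) x = (v <= visits M x)%N.
    by move=> x01; rewrite /f /= in_itv/= andbT -visits_indic// ler_nat.
  by apply/seteqP; split => x [x01 vx]; split => //; move: vx; rewrite fE.
apply: measurableI; first exact: measurable_itv.
by rewrite -[X in measurable X]setTI; apply: mf => //; exact: measurable_itv.
Qed.

(** A Markov-type bound: integrate [visits M <= v + M * 1_often]. By invariance each of the [M]
    indicators on the left has integral [mu A]. *)
Lemma mean_visits M v : M%:R * m A <= v%:R + M%:R * m (often M v).
Proof.
have mE := measurable_often M v.
have H : (\int[mu]_x (\sum_(i < M) (\1_(A_ i) x)%:E) <=
    \int[mu]_x ((v%:R)%:E + M%:R%:E * (\1_(often M v) x)%:E))%E.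
  apply: ge0_le_integral => //.
  - by move=> x _; apply: sume_ge0 => i _; rewrite lee_fin.
  - apply: emeasurable_sum => i; apply/measurable_EFinP.
    apply: measurable_indic; exact: (mA_ i).1.
  - apply: emeasurable_funD => //; apply: emeasurable_funM => //.
    by apply/measurable_EFinP; exact: measurable_indic.
  - move=> x _; rewrite sumEFin -EFinM -EFinD lee_fin.
    have [x01|x01] := pselect (`[0, 1[%classic x); last first.
      rewrite big1 ?addr_ge0 ?mulr_ge0// => i _.
      by rewrite indicE memNset// => -[].
    rewrite -visits_indic//; have [vx|vx] := leqP v (visits M x).
      rewrite indicE mem_set//= mulr1; apply: (@le_trans _ _ M%:R).
        rewrite ler_nat /visits -[leqRHS]card_ord -sum1_card.
        by apply: leq_sum => i _; case: asbool.
      by rewrite lerDr.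
    rewrite indicE memNset/=; last by move=> [_ /=]; rewrite leqNgt vx.
    by rewrite mulr0 addr0 ler_nat ltnW.
move: H; rewrite ge0_integral_sum//=; first last.
  by move=> i; apply/measurable_EFinP; apply: measurable_indic; exact: (mA_ i).1.
rewrite (eq_bigr (fun=> (m A)%:E)); last first.
  move=> i _; rewrite integral_indic//; last exact: (mA_ i).1.
  by rewrite setIT fineK ?mu_fin//; exact: (mA_ i).2.
rewrite sumEFin ge0_integralD//=; last first.
  apply: emeasurable_funM => //.
  by apply/measurable_EFinP; exact: measurable_indic.
rewrite integral_cst//= probability_setT mule1.
rewrite ge0_integralZl//=; last first.
  by apply/measurable_EFinP; exact: measurable_indic.
rewrite integral_indic// setIT sumr_const card_ord.
rewrite -[X in (_ * X)%E](fineK (mu_fin mu mE)).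
by rewrite -EFinM -EFinD lee_fin -[m A *+ M]mulr_natl.
Qed.

End Expansion.

(** * Expansion against the small number of itineraries *)

Section NoExpansion.
Context {R : realType} {n : nat}.
Variables (t : 'I_n.+1 -> R) (c : 'I_n -> R) (S : R -> R).
Variable mu : probability (measurableTypeR R) R.
Hypotheses (hS : is_itm t c S) (hmu01 : carried_by_01 mu).
Hypothesis hinv : invariant_measure mu S.
Variables (A : set (measurableTypeR R)) (r : R).
Hypotheses (mA : measurable A) (r1 : 1 < r).
Hypothesis expA : forall (k : 'I_n) (B : set (measurableTypeR R)),
  measurable B -> B `<=` A `&` branch t k ->
  r * fine (mu B) <= fine (mu (tau c k @` B)).

Local Notation m B := (fine (mu B)).

(** Bernoulli's inequality. Of 4 = 2 * 2, one factor pays for the cut made in each block and the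
    other leaves exponential growth. *)
Lemma exists_expr_ge4 : exists L, 4 <= r ^+ L.
Proof.
pose e := r - 1; have e0 : 0 < e by rewrite subr_gt0.
have B L : 1 + L%:R * e <= r ^+ L.
  elim: L => [|L IH]; first by rewrite mul0r addr0 expr0.
  rewrite exprS -natr1.
  have : 0 <= L%:R * e * e by rewrite !mulr_ge0// ltW.
  have : r * (1 + L%:R * e) <= r * r ^+ L by rewrite ler_wpM2l// ltW// (lt_trans _ r1).
  have -> : r * (1 + L%:R * e) = 1 + (L%:R + 1) * e + L%:R * e * e by rewrite /e; ring.
  lra.
exists (Num.truncn (3 / e)).+1; apply: le_trans (B _).
have : 3 / e < (Num.truncn (3 / e)).+1%:R by rewrite truncnS_gt.
rewrite ltr_pdivrMr//; lra.
Qed.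

(** The unit interval is covered by [Q] intervals of length [w < delta], and [block_bound] from time
    0 applies to each. [Q] depends on [N] only, not on [q] or [v]. *)
Lemma often_bound N : exists Q : nat, forall q v,
  r ^+ v * m (often S A (q * N) v) <= Q%:R * 2 ^+ q.
Proof.
have [D breaks] := itinerary_breaks hS N.
have [delta d0 gapD] := seq_gap D.
pose w := delta / 2; have w0 : 0 < w by rewrite divr_gt0.
have wd : w < delta by rewrite /w ltr_pdivrMr// ltr_pMr// ltr1n.
exists (Num.truncn w^-1).+1 => q v; set Q := _.+1; set E := often _ _ _ _.
have mE : measurable E by exact: (measurable_often hS hmu01 hinv mA).
have mray a : measurable (`]-oo, a[%classic : set (measurableTypeR R)).
  exact: measurable_itv.
have H i : r ^+ v * m (E `&` `]-oo, i%:R * w[) <= i%:R * 2 ^+ q.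
  elim: i => [|i IH].
    rewrite !mul0r (_ : _ `&` _ = set0) ?measure0 ?mulr0//.
    apply/seteqP; split => x // [[+ _]]; rewrite /= !in_itv/= => /andP[x0 _].
    by rewrite ltNge x0.
  have mEi : measurable (E `&` `]-oo, i.+1%:R * w[) by exact: measurableI.
  have -> : m (E `&` `]-oo, i.+1%:R * w[) = m (E `&` `]-oo, i%:R * w[) +
      m ((E `&` `]-oo, i.+1%:R * w[) `\` `]-oo, i%:R * w[).
    rewrite (measureDI mu mEi (mray (i%:R * w))) addeC fineD; first last.
    - by apply: mu_fin; exact: measurableD.
    - by apply: mu_fin; exact: measurableI.
    congr (fine (mu _) + _); rewrite -setIA; congr (_ `&` _).
    apply/seteqP; split => x /=; rewrite !in_itv/=; first by case.
    move=> xi; split => //; apply: lt_trans xi _.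
    by rewrite ltr_pM2r// ltr_nat.
  rewrite mulrDr [leRHS](_ : _ = i%:R * 2 ^+ q + 2 ^+ q); last first.
    by rewrite -natr1 mulrDl mul1r.
  apply: lerD => //.
  apply: (block_bound hS hmu01 hinv mA r1 expA breaks gapD (j := 0%N)).
  - exact: measurableD.
  - by move=> x [[[]]].
  - by [].
  - move=> x y [_ +] [[_ +] _]; rewrite /= !in_itv/= -natr1 => /negP.
    by rewrite -leNgt; lra.
  - by move=> x [[[_ ?] _] _].
apply: le_trans (H Q); rewrite (_ : _ `&` _ = E)//.
apply/seteqP; split => [x []//|x Ex]; split => //.
have [+ _] := Ex; rewrite /= !in_itv/= => /andP[_ x1].
apply: lt_trans x1 _.
have : w^-1 < Q%:R by rewrite truncnS_gt.
by rewrite -[w^-1]mul1r ltr_pdivrMr.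
Qed.

(** Take [q] blocks of length [p * L] and ask for [q * L] visits. A set of measure at least [a / 2]
    achieves them, so [4 ^+ q * (a / 2)] is at most [Q * 2 ^+ q], which fails for large [q]. *)
Lemma expanding_null : mu A = 0%E.
Proof.
have [a0|a0] := ltP 0 (m A); last first.
  have : m A = 0 by apply/eqP; rewrite eq_le a0 fine_ge0.
  by move=> aE; rewrite -(fineK (mu_fin mu mA)) aE.
exfalso; set a := m A in a0.
have [L rL] := exists_expr_ge4.
have L0 : (0 < L)%N.
  by case: L rL => //; rewrite expr0; lra.
(* With [p * a > 2] the mean number of visits exceeds twice the required [q * L]. *)
pose p := (Num.truncn (2 / a)).+1.
have pa : 2 < p%:R * a.
  have : 2 / a < p%:R by rewrite truncnS_gt.
  by rewrite ltr_pdivrMr.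
have [Q HQ] := often_bound (p * L).
(* Then [2 ^+ q * (a / 2) >= q * a / 2 > Q]. *)
pose q := (Num.truncn (2 * Q%:R / a)).+1.
have qQ : 2 * Q%:R < q%:R * a.
  have : 2 * Q%:R / a < q%:R by rewrite truncnS_gt.
  by rewrite ltr_pdivrMr.
have := HQ q (q * L)%N; set E := often _ _ _ _ => HE.
have aE : a / 2 <= m E.
  have := mean_visits hS hmu01 hinv mA (q * (p * L)) (q * L).
  rewrite -/E -/a !natrM => H.
  have qL0 : 0 < q%:R * L%:R :> R by rewrite mulr_gt0// ltr0n.
  have {}H : p%:R * a <= 1 + p%:R * m E.
    by rewrite -(ler_pM2l qL0); lra.
  have p0 : 0 < p%:R :> R by rewrite ltr0n.
  have : p%:R * (a / 2) <= p%:R * m E by lra.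
  by rewrite ler_pM2l.
have h4 : 4 ^+ q <= r ^+ (q * L).
  by rewrite mulnC exprM lerXn2r ?nnegrE// exprn_ge0// ltW// (lt_trans _ r1).
have h2 : q%:R <= 2 ^+ q :> R.
  by rewrite -natrX ler_nat ltnW// ltn_expl.
have : 2 ^+ q * (2 ^+ q * (a / 2)) <= 2 ^+ q * Q%:R.
  rewrite mulrA -exprMn (mulrC _ Q%:R); apply: le_trans HE.
  rewrite (_ : 2 * 2 = 4); last by rewrite -natrM.
  by apply: ler_pM => //; rewrite divr_ge0// ltW.
rewrite ler_pM2l ?exprn_gt0// => h.
have : q%:R * a <= 2 ^+ q * a by rewrite ler_wpM2r// ltW.
lra.
Qed.

End NoExpansion.

(** Hahn decomposition of the charge [B |-> mu (B - a) - r * mu B]; the case [a = - c k] compares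
    [mu] of [tau_k B] with [r * mu B]. *)
Lemma hahn_translate {R : realType} (mu : probability (measurableTypeR R) R)
    (a r : R) : exists P : set (measurableTypeR R), [/\ measurable P,
  (forall B : set (measurableTypeR R), measurable B -> B `<=` P ->
     r * fine (mu B) <= fine (mu ((fun y => y + a) @^-1` B))) &
  (forall B : set (measurableTypeR R), measurable B -> B `<=` ~` P ->
     fine (mu ((fun y => y + a) @^-1` B)) <= r * fine (mu B))].
Proof.
pose g := fun y : measurableTypeR R => y + a : measurableTypeR R.
have mg : measurable_fun setT g by exact: measurable_funD.
pose X : {RV mu >-> measurableTypeR R} := mfun_Sub (mem_set mg).
pose nu : {charge set (measurableTypeR R) -> \bar R} :=
  cadd (charge_of_finite_measure (distribution mu X))
       (cscale (- r) (charge_of_finite_measure mu)).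
have nuE B : measurable B ->
    nu B = (fine (mu (g @^-1` B)) - r * fine (mu B))%:E.
  move=> mB; rewrite EFinD -mulNr EFinM !fineK ?mu_fin//.
  by rewrite -[X in measurable X]setTI; exact (mg measurableT B mB).
have [P [N [[mP posP] [mN negN] PN _]]] := Hahn_decomposition nu.
exists P; split => // B mB BP.
  by have := posP _ mB BP; rewrite nuE// lee_fin subr_ge0.
have := negN _ mB; rewrite nuE// lee_fin subr_le0; apply.
move=> x /BP Px; have : (P `|` N) x by rewrite PN.
by case.
Qed.

(** * The two cut sets *)

Section MainProof.
Context {R : realType} {n : nat}.
Variables (t : 'I_n.+1 -> R) (c : 'I_n -> R) (S : R -> R).
Variable mu : probability (measurableTypeR R) R.
Hypotheses (hS : is_itm t c S) (hmu01 : carried_by_01 mu).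
Hypotheses (hna : nonatomic mu) (hinv : invariant_measure mu S).
Implicit Types (B N : set (measurableTypeR R)) (k : 'I_n) (x y : R).

Local Notation J := (supp01 mu).
Local Notation h := (cdf01 mu).
Local Notation m B := (fine (mu B)).

Let mJ : measurable (J : set (measurableTypeR R)).
Proof. exact: measurable_supp01. Qed.

(** If the image of [K] were larger, the Hahn set [P] would cut off an expanding part of [K]. That
    part is null, so its image is null by nonsingularity; the rest grows by at most [r], too
    little. *)
Lemma nonsingular_mu_tau k : branchwise_nonsingular mu t c ->
  mu (tau c k @` (J `&` branch t k)) = mu (J `&` branch t k).
Proof.
move=> ns; set K : set (measurableTypeR R) := J `&` branch t k.
have mK : measurable K by apply: measurableI => //; exact: measurable_branch.
have Kk : K `<=` branch t k by move=> x [].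
have mTK := measurable_tau c k mK.
have := le_mu_tau hS hmu01 hinv mK Kk; rewrite le_eqVlt => /predU1P[//|ltK].
exfalso.
have {}ltK : m K < m (tau c k @` K) by rewrite fine_lt ?mu_fin.
have K1 : m K <= 1.
  rewrite -[1]/(fine (1%E : \bar R)) fine_le ?mu_fin//.
  exact: probability_le1.
have K0 : 0 <= m K by exact: fine_ge0.
(* Half the excess: as [m K <= 1], [r * m K] stays strictly below the measure of the image. *)
pose r := 1 + (m (tau c k @` K) - m K) / 2.
have r1 : 1 < r by rewrite ltrDl divr_gt0// subr_gt0.
have rK : r * m K < m (tau c k @` K).
  have d0 : 0 <= m (tau c k @` K) - m K by rewrite subr_ge0 ltW.
  have := ler_wpM2l d0 K1; rewrite /r; lra.
have [P [mP posP negP]] := hahn_translate mu (- c k) r.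
have mKP : measurable (K `&` P) by exact: measurableI.
have mKD : measurable (K `\` P) by exact: measurableD.
have muKP : mu (K `&` P) = 0%E.
  apply: (expanding_null hS hmu01 hinv mKP r1) => k' B mB BKP.
  have [->|/set0P[x Bx]] := eqVneq B set0.
    by rewrite image_set0 measure0 mulr0.
  (* Expansion is required on every branch, but a point in both branches forces the same
     translation. *)
  have ck : c k' = c k.
    have [[[_ xk] _] xk'] := BKP _ Bx.
    by have := itm_tau hS xk; rewrite (itm_tau hS xk') => /addrI.
  by rewrite tau_imageE ck; apply: posP => // y /BKP[[_ ?] _].
have TKP : mu (tau c k @` (K `&` P)) = 0%E.
  by apply: ns => // x [].
have E : m (tau c k @` K) = m (tau c k @` (K `&` P)) + m (tau c k @` (K `\` P)).
  rewrite -fineD; [|by apply: mu_fin; exact: measurable_tau..].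
  rewrite -measureU.
  - by rewrite -image_setU setUIDK.
  - exact: measurable_tau.
  - exact: measurable_tau.
  - rewrite !tau_imageE -preimage_setI.
    by apply/seteqP; split => // x [[_ ?] []].
have E2 : m K = m (K `&` P) + m (K `\` P).
  by rewrite addrC -fineD ?mu_fin// -measureDI.
have : m (tau c k @` (K `\` P)) <= r * m (K `\` P).
  by rewrite tau_imageE; apply: negP => // x [].
move: rK; rewrite E E2 TKP muKP /= !add0r; lra.
Qed.

Lemma measurable_cdf_branch k (U : set R) : open U ->
  measurable (h @^-1` (U `&` `[0, 1]) `&` branch t k : set (measurableTypeR R)).
Proof.
move=> oU; apply: measurableI; last exact: measurable_branch.
apply: measurable_cdf01; apply: measurableI; last exact: measurable_itv.
exact: open_measurable.
Qed.

Lemma rhoE k (U : set R) : open U ->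
  rho mu t c k (U `&` `[0, 1]) =
  mu (other_preimages t c S k (h @^-1` (U `&` `[0, 1]) `&` branch t k)).
Proof.
move=> oU; rewrite /rho (sigmaE hS hmu01 hinv)//.
exact: measurable_cdf_branch.
Qed.

Lemma gap_null k a b : branchwise_gap mu t k a b -> mu `]a, b[%classic = 0%E.
Proof.
move=> [x xk Gx]; apply: (mu_null_sub _ _ (supp01_setC_negligible hmu01)).
  exact: measurable_itv.
by rewrite -Gx => y /connected_component_sub[].
Qed.

Lemma gap_sub_branch k a b : branchwise_gap mu t k a b ->
  `]a, b[%classic `<=` branch t k.
Proof.
move=> [x xk Gx] y; rewrite -Gx => /connected_component_sub[+ _].
by rewrite /branch /= !in_itv/= => /andP[/ltW -> ->].
Qed.

(** A gap is null and [h] is constant on it, so the whole mass of its image is defect located at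
    [h a]. *)
Lemma Cgap_sub_Cdef : Cgap mu t c `<=` Cdef mu t c.
Proof.
move=> _ [k [a [b [gap act ->]]]]; right; exists k => //.
split; first exact: cdf01_01.
move=> U oU Uha; rewrite rhoE//; apply: lt_le_trans act _.
have mG : measurable (`]a, b[%classic : set (measurableTypeR R)) by exact: measurable_itv.
have Gk := gap_sub_branch gap.
rewrite (mu_tauE hS hmu01 hinv mG Gk) (gap_null gap) add0e.
apply: le_measure; rewrite ?inE.
- exact: (measurable_other_preimages hS).
- by apply: (measurable_other_preimages hS); exact: measurable_cdf_branch.
apply: other_preimagesS => x xG; split; last exact: Gk.
rewrite /= (cdf01_const (gap_null gap) (_ : a < x < b)); last by move: xG; rewrite /= in_itv.
by split => //; exact: cdf01_01.
Qed.

Lemma negligible_other_preimages k (B : set R) : mu.-negligible (tau c k @` B) ->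
  mu.-negligible (other_preimages t c S k B).
Proof.
move=> [C [mC C0 BC]].
exists (`[0, 1[ `&` S @^-1` C); split.
- exact: (measurable_itm_preimage hS).
- by rewrite (invariant_preimage hS hmu01 hinv).
- by move=> x [[x01 _] SB]; split => //; exact: BC.
Qed.

Lemma finite_Cdef_nonsingular :
  finite_set (Cdef mu t c) -> branchwise_nonsingular mu t c.
Proof.
move=> fC k N mN NJ N0.
pose F := supp01 (rho mu t c k).
have fF : finite_set F by apply: sub_finite_set fC => x Fx; right; exists k.
have fNF : finite_set (J `&` h @^-1` F).
  rewrite (_ : _ `&` _ = \bigcup_(y in F) (J `&` h @^-1` [set y])).
    by apply: bigcup_finite => // y _; exact: supp01_cdf01_fiber_finite.
  apply/seteqP; split => [x [Jx Fx]|x [y Fy [Jx hxy]]]; first by exists (h x).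
  by split => //=; rewrite hxy.
(* Uncharged sets are described by negligible preimages rather than by [rho], so that the condition
   is hereditary without measurability of [U]. *)
pose Z (U : set R) := mu.-negligible
  (other_preimages t c S k (h @^-1` (U `&` `[0, 1]) `&` branch t k)).
have [|||G [GP Gcov]] := @lindelof_seq R Z (`[0, 1]%classic `\` F).
- rewrite /Z set0I preimage_set0 set0I /other_preimages image_set0 preimage_set0 setI0.
  exact: negligible_set0.
- move=> U V UV; apply: negligibleS; apply: other_preimagesS.
  by apply: setSI; apply: preimage_subset; exact: setSI.
- move=> y [y01 nFy]; apply: contrapT => nU; apply: nFy; split => // U oU Uy.
  rewrite lt0e rhoE// measure_ge0 andbT; apply/eqP => U0; apply: nU.
  exists U; split => //; apply: null_negligible => //.
  by apply: (measurable_other_preimages hS); exact: measurable_cdf_branch.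
have Nk : N `<=` branch t k by move=> x /NJ[].
rewrite (mu_tauE hS hmu01 hinv mN Nk) N0 add0e.
apply: (@mu_null_sub _ _ _ (other_preimages t c S k (J `&` branch t k `&` h @^-1` F) `|`
   \bigcup_i other_preimages t c S k (h @^-1` (G i `&` `[0, 1]) `&` branch t k))).
- exact: (measurable_other_preimages hS).
- rewrite -other_preimages_bigcup => x [xk [z Nz zx]].
  have [Fz|nFz] := pselect (F (h z)).
    by left; split => //; exists z => //; split => //; exact: NJ.
  right; split => //; exists z => //.
  have [|i _ Gz] := Gcov (h z); first by split => //; exact: cdf01_01.
  by exists i => //; split; [split => //; exact: cdf01_01|exact: Nk].
- apply: negligibleU; last by apply: negligible_bigcup => i; exact: (GP i).2.
  apply/negligible_other_preimages/nonatomic_finite => //; apply: finite_image.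
  by apply: sub_finite_set fNF => x [[Jx _] Fx]; split.
Qed.

Lemma nonsingular_supp_rho k : branchwise_nonsingular mu t c ->
  finite_set (Cgap mu t c) -> supp01 (rho mu t c k) `<=` Cgap mu t c.
Proof.
move=> ns fG y [y01 ysupp]; apply: contrapT => nGy.
(* Finiteness of the gap cut set enters here: its complement is an open neighbourhood of [y], and it
   remains to show that [rho] does not charge it. *)
have oU : open (~` Cgap mu t c).
  apply: closed_openC.
  have [+ _] := @accessible_finite_set_closed R; apply => //.
  exact/hausdorff_accessible/norm_hausdorff.
have := ysupp _ oU nGy; rewrite rhoE// lt0e => /andP[/eqP + _]; apply.
set U := ~` _ in oU *.
set E := h @^-1` _ `&` _.
have mE : measurable (E : set (measurableTypeR R)) by exact: measurable_cdf_branch.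
pose off : set R := off_support mu t k.
have oo : open off.
  by apply: open_setD_supp01; [exact: (lpt_ge0 hS)|exact: (rpt_le1 hS)].
have gapP x : off x -> exists a b, [/\ branchwise_gap mu t k a b,
    connected_component off x = `]a, b[%classic & a < x < b].
  move=> ox; have [||a [b ab]] := bounded_open_component oo _ _ ox.
  - by exists (lpt t k) => z [+ _]; rewrite /= in_itv/= => /andP[/ltW].
  - by exists (rpt t k) => z [+ _]; rewrite /= in_itv/= => /andP[_ /ltW].
  exists a, b; split => //; first by exists x.
  have : connected_component off x x by exact: connected_component_refl.
  by rewrite ab /= in_itv.
(* Gaps are enumerated by the rationals they contain. As [h] is constant on a gap, a gap meeting [E]
   has its rationals in [E]. *)
pose Q (o : option rat) : set R := if o is Some q then
  (if `[< (off `&` E) (ratr q) >] then connected_component off (ratr q) else set0)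
  else set0.
have Q0 o : mu.-negligible (other_preimages t c S k (Q o)).
  have O0 : mu.-negligible (other_preimages t c S k set0).
    by apply: negligible_other_preimages; rewrite image_set0; exact: negligible_set0.
  rewrite /Q; case: o => [q|//]; case: asboolP => [[offq [[Uq _] _]]|//].
  apply: negligible_other_preimages.
  have [a [b [gab ab qab]]] := gapP _ offq; rewrite ab.
  apply: null_negligible; first by apply: measurable_tau; exact: measurable_itv.
  (* A non-null image would make the gap active and put its cut value into [Cgap], which [U]
     avoids. *)
  apply: contrapT => /eqP mu0; apply: Uq; exists k, a, b; split => //.
    by rewrite /active lt0e mu0 measure_ge0.
  exact: cdf01_const (gap_null gab) qab.
have K0 : mu.-negligible (other_preimages t c S k (J `&` branch t k)).
  have mK : measurable (J `&` branch t k : set (measurableTypeR R)).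
    by apply: measurableI => //; exact: measurable_branch.
  apply: null_negligible; first exact: (measurable_other_preimages hS).
  have Kk : J `&` branch t k `<=` branch t k by move=> x [].
  rewrite -(sigmaE hS hmu01 hinv mK Kk) /sigma nonsingular_mu_tau//.
  by rewrite subee// mu_fin.
(* The left endpoint belongs to the branch but to no gap; its image is a point, hence null. *)
have L0 : mu.-negligible (other_preimages t c S k [set lpt t k]).
  by apply/negligible_other_preimages/nonatomic_finite => //; exact: finite_image.
apply: (@mu_null_sub _ _ _ (other_preimages t c S k (J `&` branch t k) `|`
  other_preimages t c S k [set lpt t k] `|`
  \bigcup_i other_preimages t c S k (Q (unpickle i)))).
- exact: (measurable_other_preimages hS).
- rewrite -other_preimages_bigcup => x [xk [z [hz zk] zx]].
  have [Jz|nJz] := pselect (J z); first by left; left; split => //; exists z.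
  have [zl|zl] := eqVneq z (lpt t k); first by left; right; split => //; exists z.
  have oz : off z.
    split => //; move: zk; rewrite /branch /= !in_itv/= => /andP[lz ->].
    by rewrite lt_neqAle eq_sym zl lz.
  have [a [b [gab ab zab]]] := gapP _ oz.
  have [q qab] : exists q : rat, ratr q \in `]a, b[.
    by apply: rat_in_itvoo; case/andP: zab; exact: lt_trans.
  have zq : connected_component off z (ratr q) by rewrite ab.
  right; split => //; exists z => //; exists (pickle q); [exact: Logic.I|].
  rewrite pickleK /Q asboolT; last first.
    split; first exact: connected_component_sub zq.
    split; last exact: (gap_sub_branch gab).
    move: hz; rewrite /= (cdf01_const (gap_null gab) zab).
    by rewrite (cdf01_const (gap_null gab) (_ : a < ratr q < b)) -?in_itv.
  exact: connected_component_sym.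
- apply: negligibleU; last by apply: negligible_bigcup => i; exact: Q0.
  exact: negligibleU.
Qed.

End MainProof.

Theorem corollary7p7 (R : realType) (n : nat)
    (t : 'I_n.+1 -> R) (c : 'I_n -> R) (S : R -> R)
    (mu : probability (measurableTypeR R) R)
    (hS : is_itm t c S) (hmu01 : carried_by_01 mu)
    (hna : nonatomic mu) (hinv : invariant_measure mu S) :
  finite_set (Cdef mu t c) <->
  (branchwise_nonsingular mu t c /\ finite_set (Cgap mu t c)).
Proof.
split=> [fC|[ns fG]].
  split; first exact: (finite_Cdef_nonsingular hS).
  by apply: sub_finite_set fC; exact: (Cgap_sub_Cdef hS).
rewrite finite_setU; split; first exact: finite_image.
apply: (@sub_finite_set _ _ (Cgap mu t c)) => // y [k _].
exact: (nonsingular_supp_rho hS hmu01 hna hinv ns fG).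
Qed.
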